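(* Fix $\sigma\in\mathbb{R}$ and $k,d\in\mathbb{Z}_{\ge0}$. Then $\mathrm{span}_{\mathbb{Q}}(L^o_{k,d}(\sigma))=\mathrm{span}_{\mathbb{Q}}(M^o_{k,d}(\sigma))$ and $\mathrm{span}_{\mathbb{Q}}(L^e_{k,d}(\sigma))=\mathrm{span}_{\mathbb{Q}}(M^e_{k,d}(\sigma))$.
   Context: $A(\theta)=\log|2\sin(\theta/2)|$, $\mathrm{Ls}_{\mathbf{k}}^{\mathbf{l}}(\sigma)=(-1)^n\int_0^{\sigma}\int_0^{\theta_n}\cdots\int_0^{\theta_2}\prod_{u=1}^n\theta_u^{l_u}A(\theta_u)^{k_u-1-l_u}\,d\theta_1\cdots d\theta_n$, $\mathrm{Ls}_\emptyset^\emptyset=1$. For $\mathbf{k}=(k_1,\dots,k_n)$, $\mathbf{l}=(l_1,\dots,l_n)$ put $s(\mathbf{k},\mathbf{l})=\sum_u(k_u-1-l_u)$ ($=0$ if $n=0$). $L^o_{k,d}(\sigma)$ (resp. $L^e_{k,d}(\sigma)$) is the set of real numbers $\mathrm{Ls}_{\mathbf{k}}^{\mathbf{l}}(\sigma)$ with $0\le n\le k$, $k_1+\dots+k_n=k$, $k_u\ge1$, $l_u\ge0$, $k_u-1-l_u\ge0$, $s(\mathbf{k},\mathbf{l})\le d$ and $s(\mathbf{k},\mathbf{l})$ odd (resp. even). $M^o_{k,d}(\sigma)$ (resp. $M^e_{k,d}(\sigma)$) is the set of real numbers $\sigma^m\mathrm{Ls}_{\mathbf{k}}^{\mathbf{l}}(\sigma)$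 with $m\ge0$, $m+k_1+\dots+k_n=k$, $0\le n\le k$, $k_u\ge2$, $l_u\ge0$, $k_u-1-l_u\ge1$, $s(\mathbf{k},\mathbf{l})\le d$ and $s(\mathbf{k},\mathbf{l})$ odd (resp. even). *)

(* Defs.v *)
From HB Require Import structures.
From mathcomp Require Import all_boot all_order all_algebra.
From mathcomp Require Import all_classical all_reals all_analysis.
Set Implicit Arguments. Unset Strict Implicit. Unset Printing Implicit Defensive.
Import Order.TTheory GRing.Theory Num.Theory.
Local Open Scope classical_set_scope.
Local Open Scope ring_scope.

Section Defs.
Variable R : realType.

Definition Afun (t : R) : R := ln `|2 * sin (t / 2)|.

Definition oint (a b : R) (f : R -> R) : R :=
  if a <= b then Rintegral lebesgue_measure `[a, b] f
  else - Rintegral lebesgue_measure `[b, a] f.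

Definition layer (kl : nat * nat) (t : R) : R :=
  t ^+ kl.2 * Afun t ^+ (kl.1 - 1 - kl.2)%N.

Fixpoint nestint (s : seq (nat * nat)) (th : R) : R :=
  match s with
  | [::] => 1
  | p :: s' => oint 0 th (fun t => layer p t * nestint s' t)
  end.

(* Ls_k^l(σ) with kl = [:: (k_1,l_1); ...; (k_n,l_n)]; θ_1 innermost. *)
Definition Ls (kl : seq (nat * nat)) (sigma : R) : R :=
  (-1) ^+ size kl * nestint (rev kl) sigma.

Definition sdeg (kl : seq (nat * nat)) : nat :=
  (\sum_(p <- kl) (p.1 - 1 - p.2))%N.

Definition wt (kl : seq (nat * nat)) : nat := (\sum_(p <- kl) p.1)%N.

Definition Lset (par : bool) (k d : nat) (sigma : R) : set R :=
  [set x | exists kl : seq (nat * nat),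
     [/\ (size kl <= k)%N, wt kl = k,
         all (fun p => (1 <= p.1)%N && (p.2 + 1 <= p.1)%N) kl &
         [/\ (sdeg kl <= d)%N, odd (sdeg kl) = par & x = Ls kl sigma]]].

Definition Mset (par : bool) (k d : nat) (sigma : R) : set R :=
  [set x | exists (m : nat) (kl : seq (nat * nat)),
     [/\ (size kl <= k)%N, (m + wt kl)%N = k,
         all (fun p => (2 <= p.1)%N && (p.2 + 2 <= p.1)%N) kl &
         [/\ (sdeg kl <= d)%N, odd (sdeg kl) = par & x = sigma ^+ m * Ls kl sigma]]].

Definition Qspan (S : set R) : set R :=
  [set x | exists c : seq (rat * R),
     all (fun p => p.2 \in S) c /\ x = \sum_(p <- c) ratr p.1 * p.2].

End Defs.

(* Main.v *)
Require Import Defs.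
From HB Require Import structures.
From mathcomp Require Import all_boot all_order all_algebra.
From mathcomp Require Import all_classical all_reals all_analysis.
From mathcomp Require Import measurable_realfun ring lra zify.
Set Implicit Arguments. Unset Strict Implicit. Unset Printing Implicit Defensive.
Import Order.TTheory GRing.Theory Num.Theory.
Import numFieldNormedType.Exports.
Local Open Scope classical_set_scope.
Local Open Scope ring_scope.

(** Read an iterated integral as a word whose letters are the forms
    [t^l A(t)^a dt], outermost letter first. Integrating [d(t^(n+1))] by parts
    gives the single identity
      [x^(n+1) I(p w)(x) = (n+1) I((t^n dt) p w)(x) + I((t^(n+1) p) w)(x)].
    Read from left to right it absorbs a power of [sigma] into words without
    such a factor; read from right to left it removes the letters with [a = 0],
    one at a time starting from the innermost one. Weight and degree in [A] are
    unchanged on every term. As [A] has logarithmic singularities at the points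
    of [2 pi Z], its powers are integrable on compact intervals, but integration
    by parts has to be done for primitives of merely integrable functions. *)

(** * Local integrability of the powers of [A] *)

Section LocalIntegrability.
Variable R : realType.
Notation mu := (@lebesgue_measure R).
Implicit Types (f g h : R -> R) (a b c : R).

Lemma integrable_itv_cat f a c b : measurable_fun setT f ->
  mu.-integrable `[a, c] (EFin \o f) -> mu.-integrable `[c, b] (EFin \o f) ->
  mu.-integrable `[a, b] (EFin \o f).
Proof.
move=> mf /integrableP[_ i1] /integrableP[_ i2].
have mE (D : set R) : measurable_fun D (EFin \o f).
  by apply/measurable_EFinP; exact: measurable_funS mf.
have mN (D : set R) : measurable_fun D (fun x => `|(EFin \o f) x|%E).
  by apply: measurableT_comp.
apply/integrableP; split; first exact: mE.
have H : (\int[mu]_(x in `[a, b]) `|(EFin \o f) x| <=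
    \int[mu]_(x in `[a, c] `|` `]c, b]) `|(EFin \o f) x|)%E.
  apply: ge0_subset_integral => //; [exact: measurableU|exact: mN|].
  move=> x /=; rewrite !in_itv/= => /andP[-> ->].
  by case: (leP x c) => _; [left|right].
apply: (le_lt_trans H); rewrite ge0_integral_setU//; last 2 first.
  exact: mN.
  apply/disj_setPS => x [/=]; rewrite !in_itv/= => /andP[_ xc] /andP[].
  by rewrite ltNge xc.
apply: lte_add_pinfty => //; apply: le_lt_trans i2.
by apply: ge0_subset_integral => //; [exact: mN|apply: subset_itvr; rewrite bnd_simp].
Qed.

(** Monotone convergence: the integral over the union is the limit of the integrals over the [F i].
    It serves to approach a singular point through sets that avoid it. *)
Lemma integrable_nondecreasing_cover (F : (set R)^nat) f (M : R) :
  nondecreasing_seq F -> (forall i, measurable (F i)) ->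
  measurable_fun setT f -> (forall x, 0 <= f x) ->
  (forall i, \int[mu]_(x in F i) (f x)%:E <= M%:E)%E ->
  mu.-integrable (\bigcup_i F i) (EFin \o f).
Proof.
move=> nF mF mf f0 FM.
have mE (D : set R) : measurable_fun D (EFin \o f).
  by apply/measurable_EFinP; exact: measurable_funS mf.
apply/integrableP; split; first exact: mE.
under eq_integral => x _ do rewrite /= ger0_norm//.
apply: (@le_lt_trans _ _ M%:E); last exact: ltry.
have H : (\int[mu]_(x in F i) (f x)%:E)%E @[i --> \oo] -->
    (\int[mu]_(x in \bigcup_i F i) (f x)%:E)%E.
  apply: ge0_nondecreasing_set_cvg_integral => //.
  + by move=> i; exact: mE.
  + by move=> i x _; rewrite lee_fin.
 rewrite -(cvg_lim _ H)//.
apply: lime_le; first by apply/cvg_ex; eexists; exact: H.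
exact: nearW.
Qed.

(* The sign [s] selects the side of [c] on which [a, b] lies. *)
Lemma integral_inv_sqrt (s c a b : R) : s ^+ 2 = 1 -> a < b ->
  (forall t, a <= t <= b -> 0 < s * (t - c)) ->
  (\int[mu]_(t in `[a, b]) ((Num.sqrt (s * (t - c)))^-1)%:E =
   (s * 2 * Num.sqrt (s * (b - c)) - s * 2 * Num.sqrt (s * (a - c)))%:E)%E.
Proof.
move=> s2 ab pos.
pose P (t : R) := s * 2 * Num.sqrt (s * (t - c)).
have dP t : a <= t <= b -> is_derive t 1 P ((Num.sqrt (s * (t - c)))^-1).
  move=> /pos st.
  pose g (t : R) := s * (t - c).
  have d1 : is_derive t (1 : R) g s.
    have := is_deriveZ s
      (is_deriveB (is_derive_id t (1 : R)) (is_derive_cst c t (1 : R))).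
    by rewrite subr0 /GRing.scale/= mulr1.
  have d2 := @is_derive1_comp _ Num.sqrt g _ _ _ (is_derive1_sqrt st) d1.
  have d3 := is_deriveZ (s * 2) d2.
  apply: (is_derive_eq d3).
  rewrite /GRing.scale/= /g -[RHS]mul1r -s2; field.
  apply/andP; split; first by rewrite gt_eqF// sqrtr_gt0.
  by apply: contraTneq st => ->; rewrite mul0r ltxx.
have cP t : a <= t <= b -> {for t, continuous P}.
  by move=> /dP[dt _]; exact/differentiable_continuous/derivable1_diffP.
rewrite EFinB; apply: (@continuous_FTC2 _ _ P) => //.
- apply: continuous_in_subspaceT => t /set_mem /=; rewrite in_itv/= => /pos st.
  apply: cvgV; first by rewrite gt_eqF// sqrtr_gt0.
  apply: (@continuous_comp _ _ _ (fun t : R => s * (t - c))); last first.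
    exact: sqrt_continuous.
  by apply: cvgM; [exact: cvg_cst|apply: cvgB; [exact: cvg_id|exact: cvg_cst]].
- split.
  + move=> t; rewrite in_itv/= => /andP[/ltW at' /ltW tb].
    by case: (dP t); rewrite ?at'.
  + by apply: cvg_at_right_filter; apply: cP; rewrite lexx ltW.
  + by apply: cvg_at_left_filter; apply: cP; rewrite lexx ltW.
- move=> t; rewrite in_itv/= => /andP[/ltW at' /ltW tb].
  by rewrite derive1E; have [|_ ->] := dP t; rewrite ?at'.
Qed.

Lemma measurable_inv_sqrt_dist c :
  measurable_fun setT (fun t : R => (Num.sqrt `|t - c|)^-1).
Proof.
rewrite (_ : (fun _ => _) = (@powR R ^~ (- 2^-1)) \o (fun t => `|t - c|)).
  apply: measurableT_comp; first exact: measurable_powR.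
  by apply: measurableT_comp => //; exact: measurable_funB.
by apply/funext => t /=; rewrite powRN powR12_sqrt.
Qed.

(** A gap of radius [r n] around [c] is cut out and shrunk. On either side the explicit primitive
    bounds the integral by [2 sqrt e], whatever the gap. *)
Lemma integrable_inv_sqrt_dist c (e : R) : 0 < e ->
  mu.-integrable `[c - e, c + e] (EFin \o (fun t => (Num.sqrt `|t - c|)^-1)).
Proof.
move=> e0; set h := (fun t : R => (Num.sqrt `|t - c|)^-1).
have mh : measurable_fun setT h := @measurable_inv_sqrt_dist c.
have h0 t : 0 <= h t by rewrite invr_ge0 sqrtr_ge0.
have mE (D : set R) : measurable_fun D (EFin \o h).
  by apply/measurable_EFinP; exact: measurable_funS mh.
(* The denominator [n + 2] gives [r n < e] for [n = 0] as well, so that both pieces of [F n] have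
   positive length. *)
pose r n : R := e / n.+2%:R.
have r0 n : 0 < r n by rewrite divr_gt0.
have re n : r n < e by rewrite ltr_pdivrMr// ltr_pMr// ltr1n.
have rm n m : (n <= m)%N -> r m <= r n.
  by move=> nm; rewrite ler_wpM2l ?(ltW e0)// lef_pV2 ?posrE// ler_nat.
pose F n : set R := `[c - e, c - r n] `|` `[c + r n, c + e].
(* The point [c] is a null set; what remains is the increasing union of the [F n]. *)
have [_] := @negligible_integrable _ _ _ mu `[c - e, c + e]%classic [set c] (EFin \o h)
  (measurable_set1 c) (measurable_itv _) (mE _) (lebesgue_measure_set1 c).
apply.
have -> : `[c - e, c + e]%classic `\ c = \bigcup_n F n.
  apply/seteqP; split => t /=; rewrite in_itv/=.
    move=> [/andP[t1 t2] /eqP tc].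
    have d0 : 0 < `|t - c| by rewrite normr_gt0 subr_eq0.
    have [n rn] : exists n, r n <= `|t - c|.
      exists (Num.truncn (e / `|t - c|)).
      rewrite ler_pdivrMr// mulrC -ler_pdivrMr//.
      apply: ltW; apply: lt_trans (truncnS_gt _) _; by rewrite ltr_nat.
    exists n => //; rewrite /F /= !in_itv/= t1 t2 /= andbT.
    move: rn; rewrite ler_normr => /orP[|] H; [right|left]; lra.
  move=> [n _]; rewrite /F /= !in_itv/= => -[] /andP[t1 t2]; have := r0 n; have := re n => u1 u2.
    split; first by lra.
    by move=> tc; lra.
  by split; [lra|move=> tc; lra].
apply: (@integrable_nondecreasing_cover F h (4 * Num.sqrt e)) => //.
- move=> n m nm; rewrite subsetEset /F => t /=; rewrite !in_itv/=.
  by have := rm _ _ nm => rmn [] /andP[t1 t2]; [left|right]; lra.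
- by move=> n; exact: measurableU.
move=> n; rewrite /F ge0_integral_setU//; last 3 first.
- exact: mE.
- by move=> x _; rewrite lee_fin.
- apply/disj_setPS => x [/=]; rewrite !in_itv/= => /andP[_ xc] /andP[xc' _].
  have := r0 n; lra.
have q0 : 0 <= Num.sqrt (r n) by exact: sqrtr_ge0.
have A1 : (\int[mu]_(x in `[(c - e)%R, (c - r n)%R]) (h x)%:E <= (2 * Num.sqrt e)%:E)%E.
  have -> : (\int[mu]_(x in `[(c - e)%R, (c - r n)%R]) (h x)%:E =
      \int[mu]_(x in `[(c - e)%R, (c - r n)%R]) ((Num.sqrt ((-1) * (x - c)))^-1)%:E)%E.
    apply: eq_integral => t /set_mem /=; rewrite in_itv/= => /andP[_ t2].
    rewrite /h ler0_norm ?mulN1r//; have := r0 n; lra.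
  rewrite integral_inv_sqrt.
  - rewrite lee_fin.
    have -> : -1 * (c - r n - c) = r n by ring.
    have -> : -1 * (c - e - c) = e by ring.
    lra.
  - by rewrite sqrrN expr1n.
  - have := re n; lra.
  - move=> t /andP[_ t2]; have := r0 n; lra.
have A2 : (\int[mu]_(x in `[(c + r n)%R, (c + e)%R]) (h x)%:E <= (2 * Num.sqrt e)%:E)%E.
  have -> : (\int[mu]_(x in `[(c + r n)%R, (c + e)%R]) (h x)%:E =
      \int[mu]_(x in `[(c + r n)%R, (c + e)%R]) ((Num.sqrt (1 * (x - c)))^-1)%:E)%E.
    apply: eq_integral => t /set_mem /=; rewrite in_itv/= => /andP[t1 _].
    rewrite /h ger0_norm ?mul1r//; have := r0 n; lra.
  rewrite integral_inv_sqrt.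
  - rewrite lee_fin.
    have -> : 1 * (c + r n - c) = r n by ring.
    have -> : 1 * (c + e - c) = e by ring.
    lra.
  - by rewrite expr1n.
  - have := re n; lra.
  - move=> t /andP[t1 _]; have := r0 n; lra.
apply: le_trans (leeD A1 A2) _; rewrite -EFinD lee_fin; lra.
Qed.

(* Compactness provides one step [1/(n+1)] valid at every point of [a, b]. *)
Lemma integrable_itv_of_local f : measurable_fun setT f ->
  (forall c, exists2 e, 0 < e & mu.-integrable `[c - e, c + e] (EFin \o f)) ->
  forall a b, mu.-integrable `[a, b] (EFin \o f).
Proof.
move=> mf loc a b.
have [ba|ab] := ltP b a.
  rewrite set_itv_ge -?ltNge ?bnd_simp//.
  by have [e e0] := loc 0; apply: integrableS.
have : \forall n \near \oo, `[a, b] `<=`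
    (fun x => mu.-integrable `[x, x + n.+1%:R^-1] (EFin \o f)).
  apply: (compact_near_coveringP `[a, b]).1; first exact: segment_compact.
  move=> x _; have [e e0 ie] := loc x.
  (* A point [y] within [e / 2] of [x] and a step below [e / 2] keep [[y, y + 1/(n+1)]] inside
     [[x - e, x + e]]. *)
  exists (ball x (e / 2), [set n | (Num.truncn (2 / e) <= n)%N]).
    by split; [apply: nbhsx_ballx; rewrite divr_gt0|exists (Num.truncn (2 / e))].
  move=> [y n] [/= yx tn].
  have ne : n.+1%:R^-1 < e / 2 :> R.
    rewrite -[e / 2]invrK ltf_pV2 ?posrE ?invr_gt0 ?divr_gt0// invf_div.
    by apply: lt_le_trans (truncnS_gt _) _; rewrite ler_nat.
  move: (n.+1%:R^-1) ne => q ne; move: yx; rewrite /ball/= ltr_distl => /andP[y1 y2].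
  by apply: integrableS ie => //; apply: subset_itvScc; rewrite bnd_simp; lra.
move=> [n _ /(_ n (leqnn n)) covn].
(* Integrability advances by [1/(n+1)] at a time; the minimum with [b] keeps the start of the next
   step inside [[a, b]], where the covering applies. *)
have step j : mu.-integrable `[a, Num.min b (a + j%:R / n.+1%:R)] (EFin \o f).
  elim: j => [|j IH].
    have [e e0] := loc a; rewrite mul0r addr0 min_r//.
    by apply: integrableS => //; apply: subset_itvScc; rewrite bnd_simp; lra.
  have n0 : 0 < n.+1%:R^-1 :> R by rewrite invr_gt0.
  have j0 : 0 <= j%:R / n.+1%:R :> R by rewrite divr_ge0.
  set x := Num.min b _ in IH.
  have xab : `[a, b]%classic x.
    by rewrite /= in_itv/= /x ge_min lexx le_min ab/= lerDl j0.
  have := integrable_itv_cat mf IH (covn _ xab).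
  apply: integrableS => //; apply: subset_itvScc; rewrite bnd_simp//.
  rewrite /x -natr1 mulrDl mul1r addrA !minEle.
  move: (j%:R / _) j0 => w j0; move: (n.+1%:R^-1) n0 => q n0.
  by case: ifPn; case: ifPn; rewrite -?ltNge; lra.
have [j bj] : exists j : nat, b - a <= j%:R / n.+1%:R.
  exists (Num.truncn ((b - a) * n.+1%:R)).+1.
  by rewrite ler_pdivlMr//; apply/ltW/truncnS_gt.
by have := step j; rewrite min_l// -lerBlDl.
Qed.

(** [x^n / n!] is one term of the exponential series, whose terms are all nonnegative. *)
Lemma expr_le_fact_expR n (x : R) : 0 <= x -> x ^+ n <= n`!%:R * expR x.
Proof.
case: n => [|n] x0; first by rewrite expr0 fact0 mul1r -[leLHS]expR0 ler_expR.
rewrite mulrC -ler_pdivrMr ?ltr0n ?fact_gt0//.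
by apply: le_trans (expR_ge1Dxn n x0); rewrite lerDr.
Qed.

Lemma sqrt_expR_ln (u : R) : 0 < u -> Num.sqrt u = expR (ln u / 2).
Proof.
move=> u0; have {1}-> : u = expR (ln u / 2) ^+ 2.
  by rewrite -expRM_natl mulrC divfK// lnK.
by rewrite sqrtr_sqr ger0_norm// expR_ge0.
Qed.

(** With [v = - ln u / 2 >= 0] one has [1 / sqrt u = exp v], and the claim is the exponential bound
    for [(2 v)^n]. *)
Lemma Nln_expr_le n (u : R) : 0 < u <= 1 ->
  (- ln u) ^+ n <= 2 ^+ n * n`!%:R / Num.sqrt u.
Proof.
move=> /andP[u0 u1].
have -> : - ln u = 2 * (- ln u / 2) by field.
rewrite exprMn -mulrA ler_pM2l ?exprn_gt0// sqrt_expR_ln// -expRN -mulNr.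
by apply: expr_le_fact_expR; rewrite divr_ge0// oppr_ge0 ln_le0.
Qed.

Lemma integrable_itv_dominated f g a b : measurable_fun setT f ->
  (forall t, a <= t <= b -> `|f t| <= g t) ->
  mu.-integrable `[a, b] (EFin \o g) -> mu.-integrable `[a, b] (EFin \o f).
Proof.
move=> mf fg; apply: le_integrable => //.
  by apply/measurable_EFinP; exact: measurable_funS mf.
move=> t /=; rewrite in_itv/= => /fg ftg.
by rewrite lee_fin (le_trans ftg)// ler_norm.
Qed.

Lemma continuous_integrable_itv f a b : continuous f ->
  mu.-integrable `[a, b] (EFin \o f).
Proof.
move=> cf; apply: continuous_compact_integrable; first exact: segment_compact.
exact: continuous_subspaceT.
Qed.

Lemma integrable_of_continuous_at f c : measurable_fun setT f ->
  {for c, continuous f} ->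
  exists2 e, 0 < e & mu.-integrable `[c - e, c + e] (EFin \o f).
Proof.
move=> mf /cvgrPdist_lt /(_ 1 ltr01) /nbhs_ballP[e /= e0 be].
exists (e / 2); first by rewrite divr_gt0.
apply: (@integrable_itv_dominated _ (cst (`|f c| + 1))) => //.
  move=> t tc; have /be : ball c e t by rewrite /ball/= ltr_distl; lra.
  rewrite -lerBlDl => /ltW; apply: le_trans.
  by rewrite distrC lerB_dist.
by apply: continuous_integrable_itv => x; exact: cst_continuous.
Qed.

Lemma integrable_EFinD (D : set (measurableTypeR R)) f g : measurable D ->
  mu.-integrable D (EFin \o f) -> mu.-integrable D (EFin \o g) ->
  mu.-integrable D (EFin \o (fun t => f t + g t)).
Proof. by move=> mD; exact: integrableD. Qed.

Lemma integrable_EFinZ (D : set (measurableTypeR R)) (k : R) f : measurable D ->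
  mu.-integrable D (EFin \o f) ->
  mu.-integrable D (EFin \o (fun t => k * f t)).
Proof. by move=> mD; exact: integrableZl. Qed.

(** The difference quotients at [c] tend to [l], of modulus 1, so near [c] their modulus is at least
    1/2. Applied to [2 sin(t/2)], this bounds [A] from below near its singularities. *)
Lemma linear_lower_bound_at_simple_zero f c (l : R) : is_derive c 1 f l ->
  f c = 0 -> `|l| = 1 ->
  exists2 e : R, 0 < e & forall t, `|t - c| < e -> `|t - c| / 2 <= `|f t|.
Proof.
move=> [df dl] fc l1.
have H : h^-1 *: ((f \o shift c) (h *: 1) - f c) @[h --> 0^'] --> l.
  by rewrite -dl; exact: df.
have half0 : 0 < 1 / 2 :> R by lra.
move/cvgrPdist_lt : H => /(_ _ half0) /nbhs_ballP[e /= e0 be].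
exists e => // t te; have [->|tc] := eqVneq t c.
  by rewrite subrr normr0 mul0r.
have /be : ball (0 : R) e (t - c) by rewrite /ball/= sub0r normrN.
rewrite subr_eq0 => /(_ tc); rewrite fc subr0 /= /GRing.scale/= mulr1 subrK => H1.
have d0 : 0 < `|t - c| by rewrite normr_gt0 subr_eq0.
have : 1 / 2 <= `|(t - c)^-1 * f t|.
  by have := lerB_dist l ((t - c)^-1 * f t); rewrite l1; move: H1; lra.
by rewrite normrM normfV [leRHS]mulrC ler_pdivlMr// mulrC mulrA mulr1.
Qed.

Lemma measurable_Afun : measurable_fun setT (@Afun R).
Proof.
apply: measurableT_comp; first exact: measurable_ln.
apply: measurableT_comp => //.
apply: continuous_measurable_fun => t; apply: cvgM; first exact: cvg_cst.
apply: continuous_comp; last exact: continuous_sin.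
by apply: cvgM; [exact: cvg_id|exact: cvg_cst].
Qed.

(* At a zero [c] of the sine, [-A(t) <= - ln (`|t - c| / 2)] near [c], and any
   power of it is dominated by [`|t - c|^(-1/2)]. *)
Lemma integrable_Afun_expr n a b :
  mu.-integrable `[a, b] (EFin \o (fun t => Afun t ^+ n)).
Proof.
pose s (t : R) := 2 * sin (t / 2).
have mA : measurable_fun setT (fun t : R => Afun t ^+ n).
  by apply: measurable_funX; exact: measurable_Afun.
apply: integrable_itv_of_local => // c.
have ds : is_derive c (1 : R) s (cos (c / 2)).
  have d1 : is_derive c (1 : R) (fun t => t / 2) (2^-1).
    have := is_deriveZ (2^-1) (is_derive_id c (1 : R)).
    rewrite /GRing.scale/= mulr1; congr (is_derive _ _ _ _).
    by apply/funext => t /=; rewrite mulrC.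
  have := is_deriveZ 2 (@is_derive1_comp _ _ (fun t => t / 2) _ _ _ (is_derive_sin (c / 2)) d1).
  by rewrite /GRing.scale/= mulrCA divff// mulr1.
have cs : {for c, continuous s}.
  by case: ds => d _; exact/differentiable_continuous/derivable1_diffP.
(* Where the sine does not vanish, [A] is continuous and its powers are locally bounded. *)
have [sc|sc] := eqVneq (s c) 0; last first.
  apply: integrable_of_continuous_at => //.
  apply: (@continuous_comp _ _ _ (@Afun R) (fun x : R => x ^+ n)); last first.
    exact: exprn_continuous.
  apply: (@continuous_comp _ _ _ (fun t => `|s t|) (@ln R)).
    by apply: cvg_norm.
  by apply: continuous_ln; rewrite normr_gt0.
(* At a zero of the sine the cosine, which is the slope of [s], is 1 or -1. *)
have cos1 : `|cos (c / 2)| = 1.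
  apply/eqP; rewrite -(@eqrXn2 _ 2)// ?expr1n// real_normK ?num_real//.
  move/eqP: sc; rewrite mulf_eq0 pnatr_eq0/= => /eqP s0.
  by rewrite cos2sin2 s0 expr0n subr0.
have [e1 e10 lb] := linear_lower_bound_at_simple_zero ds sc cos1.
move/cvgrPdist_lt : cs => /(_ _ ltr01) /nbhs_ballP[e2 /= e20 ub].
pose e := Num.min e1 e2 / 2.
have e0 : 0 < e by rewrite divr_gt0// lt_min e10.
exists e => //.
(* The constant of [Nln_expr_le] at [u = |t - c| / 2], with the factor [sqrt (1/2)] of [sqrt u]
   moved into it. *)
pose K : R := 2 ^+ n * n`!%:R / Num.sqrt 2^-1.
have K0 : 0 <= K by rewrite divr_ge0 ?sqrtr_ge0// mulr_ge0// exprn_ge0.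
(* The summand 1 covers [t = c], where [ln 0 = 0] and [0^-1 = 0] by convention: there the power of
   [A] is [0^n] and the second summand vanishes. *)
apply: (@integrable_itv_dominated _ (fun t => 1 + K * (Num.sqrt `|t - c|)^-1)) => //.
  move=> t tc; have te : `|t - c| < Num.min e1 e2.
    by rewrite ltr_distl; move: tc e0; rewrite /e; lra.
  have [->|tnc] := eqVneq t c.
    rewrite /Afun -/(s c) sc normr0 ln0// subrr normr0 sqrtr0 invr0 mulr0 addr0.
    by rewrite normrX normr0 exprn_ile1.
  have d0 : 0 < `|t - c| by rewrite normr_gt0 subr_eq0.
  have [t1 t2] : `|t - c| < e1 /\ `|t - c| < e2 by move: te; rewrite lt_min => /andP.
  have st := lb _ t1.
  have st0 : 0 < `|s t| by apply: lt_le_trans st; rewrite divr_gt0.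
  have st1 : `|s t| <= 1.
    have /ub : ball c e2 t by rewrite /ball/= distrC.
    by rewrite sc sub0r normrN => /ltW.
  rewrite /Afun -/(s t) normrX ler0_norm ?ln_le0//.
  have u1 : 0 < `|t - c| / 2 <= 1 by rewrite divr_gt0//= (le_trans st).
  apply: (@le_trans _ _ ((- ln (`|t - c| / 2)) ^+ n)).
    by rewrite lerXn2r ?nnegrE ?oppr_ge0 ?ln_le0 ?lerN2 ?ler_ln ?posrE//; case/andP: u1.
  apply: le_trans (Nln_expr_le _ u1) _.
  rewrite sqrtrM// invfM (mulrC (_^-1)) mulrA.
  by rewrite lerDr.
apply: integrable_EFinD => //.
  by apply: continuous_integrable_itv => x; exact: cst_continuous.
by apply: integrable_EFinZ => //; exact: integrable_inv_sqrt_dist.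
Qed.

End LocalIntegrability.

(** * Oriented integrals of locally integrable functions *)

Section OrientedIntegral.
Variable R : realType.
Notation mu := (@lebesgue_measure R).
Implicit Types (f g h F : R -> R) (a b c : R).

Definition locint f := forall a b, mu.-integrable `[a, b] (EFin \o f).

Lemma locintD f g : locint f -> locint g -> locint (fun t => f t + g t).
Proof. by move=> lf lg a b; exact: integrable_EFinD. Qed.

Lemma locintZ k f : locint f -> locint (fun t => k * f t).
Proof. by move=> lf a b; exact: integrable_EFinZ. Qed.

Lemma locint_sum (I : Type) (r : seq I) (f : I -> R -> R) :
  (forall i, locint (f i)) -> locint (fun t => \sum_(i <- r) f i t).
Proof.
move=> lf; elim: r => [|i r IH].
  rewrite (_ : (fun _ => _) = cst 0); last by apply/funext => t; rewrite big_nil.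
  by move=> a b; apply: continuous_integrable_itv => x; exact: cst_continuous.
rewrite (_ : (fun _ => _) = (fun t => f i t + \sum_(i <- r) f i t)); last first.
  by apply/funext => t; rewrite big_cons.
exact: locintD.
Qed.

Lemma continuous_locint f : continuous f -> locint f.
Proof. by move=> cf a b; exact: continuous_integrable_itv. Qed.

Lemma continuous_bounded_itv f a b : continuous f ->
  exists2 C, 0 <= C & forall t, a <= t <= b -> `|f t| <= C.
Proof.
move=> cf; have [ab|ba] := leP a b; last first.
  by exists 0 => // t /andP[at' tb]; have := le_trans at' tb; rewrite leNgt ba.
have cn : {within `[a, b], continuous (fun t => `|f t|)}.
  by apply: continuous_subspaceT => t; apply: cvg_norm; exact: cf.
have [c _ fc] := EVT_max ab cn.
by exists `|f c| => // t tab; apply: fc; rewrite in_itv.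
Qed.

Lemma locintM h f : continuous h -> locint f -> locint (fun t => h t * f t).
Proof.
move=> ch lf a b; have [C C0 hC] := continuous_bounded_itv a b ch.
apply: (@integrableMr _ _ _ mu `[a, b]%classic _ h (EFin \o f)) => //.
  by apply: measurable_funS (continuous_measurable_fun ch).
exists C; split; first exact: num_real.
move=> M CM t /=; rewrite in_itv/= => /hC htC.
exact/ltW/(le_lt_trans htC).
Qed.

Lemma Rintegral_itv_cat f a c b : locint f -> a <= c <= b ->
  \int[mu]_(t in `[a, b]) f t =
  \int[mu]_(t in `[a, c]) f t + \int[mu]_(t in `[c, b]) f t.
Proof.
move=> lf /andP[ac cb]; apply/eqP; rewrite addrC -subr_eq; apply/eqP.
rewrite Rintegral_itvB ?bnd_simp//.
rewrite Rintegral_itv_obnd_cbnd//.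
by apply: integrableS (lf c b) => //; exact: subset_itv_oc_cc.
Qed.

Lemma oint00 f : oint 0 0 f = 0.
Proof. by rewrite /oint lexx set_itv1 Rintegral_set1. Qed.

(** Three positions of 0 relative to [a <= b] are possible; the sign in [oint] makes the formula the
    same in each. *)
Lemma ointB f a b : locint f -> a <= b ->
  oint 0 b f - oint 0 a f = \int[mu]_(t in `[a, b]) f t.
Proof.
move=> lf ab; rewrite /oint.
case: ifPn => [b0|]; case: ifPn => [a0|].
- by rewrite (@Rintegral_itv_cat f 0 a b)// ?a0// addrAC subrr add0r.
- rewrite -ltNge => /ltW a0; rewrite (@Rintegral_itv_cat f a 0 b)// ?a0//.
  by rewrite opprK addrC.
- by rewrite -ltNge => b0; have := lt_le_trans b0 (le_trans a0 ab); rewrite ltxx.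
- move=> _; rewrite -ltNge => /ltW b0.
  by rewrite (@Rintegral_itv_cat f a b 0)// ?ab// opprK addrC addrK.
Qed.

Lemma eq_oint f g x : f =1 g -> oint 0 x f = oint 0 x g.
Proof. by move=> /funext ->. Qed.

Lemma ointD f g x : locint f -> locint g ->
  oint 0 x (fun t => f t + g t) = oint 0 x f + oint 0 x g.
Proof.
move=> lf lg; rewrite /oint; case: ifPn => _; rewrite RintegralD ?opprD//.
Qed.

Lemma ointZ k f x : locint f -> oint 0 x (fun t => k * f t) = k * oint 0 x f.
Proof. by move=> lf; rewrite /oint; case: ifPn => _; rewrite RintegralZl ?mulrN. Qed.

Lemma oint_sum (I : Type) (r : seq I) (f : I -> R -> R) x :
  (forall i, locint (f i)) ->
  oint 0 x (fun t => \sum_(i <- r) f i t) = \sum_(i <- r) oint 0 x (f i).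
Proof.
move=> lf; elim: r => [|i r IH].
  rewrite big_nil (@eq_oint _ (fun t => 0 * 0)).
    by rewrite ointZ ?mul0r//; apply: continuous_locint => t; exact: cst_continuous.
  by move=> t; rewrite big_nil mul0r.
rewrite big_cons -IH -ointD//; last exact: locint_sum.
by apply: eq_oint => t; rewrite big_cons.
Qed.

Lemma continuous_oint f : locint f -> continuous (fun x => oint 0 x f).
Proof.
move=> lf x.
have x1 : x - 1 < x + 1 by lra.
have /(continuous_within_itvP _ x1)[cp _ _] :=
  parameterized_integral_continuous (ltW x1) (lf (x - 1) (x + 1)).
have {}cp : {for x, continuous (fun y => parameterized_integral mu (x - 1) y f)}.
  by apply: cp; rewrite in_itv/=; lra.
have cc : {for x, continuous (fun y => oint 0 (x - 1) f +
    parameterized_integral mu (x - 1) y f)}.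
  by apply: cvgD; [exact: cvg_cst|exact: cp].
(* Moving the base point from 0 to [x - 1] puts [x] in the interior of an interval on which the
   indefinite integral is continuous. *)
have E y : x - 1 <= y -> oint 0 y f =
    oint 0 (x - 1) f + parameterized_integral mu (x - 1) y f.
  by move=> xy; rewrite /parameterized_integral -ointB// addrC subrK.
rewrite /continuous_at E; last by lra.
apply: cvg_trans cc; apply: near_eq_cvg.
near=> y; apply/esym/E.
by near: y; exists 1 => //= z; rewrite /= ltr_distl => /andP[]; lra.
Unshelve. all: by end_near. Qed.

End OrientedIntegral.

(** * Integration by parts against a merely integrable function *)

Section IntegrationByParts.
Variable R : realType.
Notation mu := (@lebesgue_measure R).
Implicit Types (f g h F : R -> R) (a b c : R).

(* Subdivide [a, b] into [n] equal pieces: the bounds telescope to [O(1/n)]. *)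
Lemma eq_of_superlinear_increments (H Gam : R -> R) (C a b : R) : a <= b -> 0 <= C ->
  (forall x y, a <= x -> x <= y -> y <= b ->
    `|H y - H x| <= C * (y - x) * (Gam y - Gam x)) ->
  H b = H a.
Proof.
move=> ab C0 inc.
have step n j : (j <= n.+1)%N ->
  `|H (a + j%:R / n.+1%:R * (b - a)) - H a| <=
  C * ((b - a) / n.+1%:R) * (Gam (a + j%:R / n.+1%:R * (b - a)) - Gam a).
  elim: j => [|j IH] jn; first by rewrite !mul0r addr0 !subrr normr0 mulr0.
  set x := a + j%:R / _ * _ in IH *.
  set y := a + _ / _ * _.
  have yx : y - x = (b - a) / n.+1%:R.
    by rewrite /y /x -natr1; ring.
  have ax : a <= x by rewrite lerDl mulr_ge0 ?divr_ge0// subr_ge0.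
  have xy : x <= y by rewrite -subr_ge0 yx divr_ge0// subr_ge0.
  have yb : y <= b.
    rewrite /y -lerBrDl -[leRHS]mul1r ler_wpM2r ?subr_ge0//.
    by rewrite ler_pdivrMr// mul1r ler_nat.
  have := inc _ _ ax xy yb; rewrite yx => A1; have A2 := IH (ltnW jn).
  have -> : H y - H a = (H y - H x) + (H x - H a) by ring.
  apply: le_trans (ler_normD _ _) _; apply: le_trans (lerD A1 A2) _.
  by rewrite -mulrDr addrA subrK.
have all n : `|H b - H a| <= C * (b - a) * (Gam b - Gam a) / n.+1%:R.
  have := step n n.+1 (leqnn _); rewrite divff// mul1r subrKC => /le_trans; apply.
  by rewrite mulrA [leLHS]mulrAC.
apply/eqP; rewrite -subr_eq0 -normr_le0; apply/ler_addgt0Pr => e e0; rewrite add0r.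
set K := C * (b - a) * (Gam b - Gam a) in all.
apply: le_trans (all (Num.truncn (K / e))) _.
rewrite ler_pdivrMr// mulrC -ler_pdivrMr//.
exact/ltW/truncnS_gt.
Qed.

Lemma integral_derivative F f a b : (forall x : R, is_derive x 1 F (f x)) ->
  continuous f -> a <= b -> \int[mu]_(t in `[a, b]) f t = F b - F a.
Proof.
move=> dF cf; rewrite le_eqVlt => /predU1P[->|ab].
  by rewrite set_itv1 Rintegral_set1 subrr.
have cF x : {for x, continuous F}.
  by case: (dF x) => d _; exact/differentiable_continuous/derivable1_diffP.
rewrite /Rintegral (@continuous_FTC2 _ _ F)//.
- exact: continuous_subspaceT.
- split.
  + by move=> x _; case: (dF x).
  + exact/cvg_at_right_filter/cF.
  + exact/cvg_at_left_filter/cF.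
- by move=> x _; rewrite derive1E; case: (dF x).
Qed.

Lemma oint_derivative F f x : (forall x : R, is_derive x 1 F (f x)) ->
  continuous f -> oint 0 x f = F x - F 0.
Proof.
move=> dF cf; rewrite /oint; case: ifPn => [x0|].
  exact: integral_derivative.
by rewrite -ltNge => /ltW x0; rewrite (@integral_derivative F)// opprB.
Qed.

Lemma normr_Rintegral_le f g a b : locint f -> locint g ->
  (forall t, a <= t <= b -> `|f t| <= g t) ->
  `|\int[mu]_(t in `[a, b]) f t| <= \int[mu]_(t in `[a, b]) g t.
Proof.
move=> lf lg fg; apply: le_trans (le_normr_Rintegral _ (lf a b)) _ => //.
apply: le_Rintegral => //.
exact: (integrable_norm (lf a b)).
Qed.

Lemma locint_norm f : locint f -> locint (fun t => `|f t|).
Proof. by move=> lf a b; exact: (integrable_norm (lf a b)). Qed.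

Lemma Rintegral_itv_cst (k a b : R) : a <= b ->
  \int[mu]_(t in `[a, b]) k = k * (b - a).
Proof.
move=> ab; rewrite Rintegral_cst//= lebesgue_measure_itv/= lte_fin.
case: ltP => [//|ba]; rewrite (_ : b = a) ?subrr//.
by apply/eqP; rewrite eq_le ab ba.
Qed.

(* [g] is only integrable, so [t |-> oint 0 t g] need not be differentiable: the
   difference [H] of the two sides is shown to be constant by bounding its
   increments by the product of those of [t] and of the integral of [`|g|]. *)
Lemma oint_by_parts F f g x : (forall x : R, is_derive x 1 F (f x)) ->
  continuous f -> locint g ->
  F x * oint 0 x g = oint 0 x (fun t => f t * oint 0 t g) +
                     oint 0 x (fun t => F t * g t).
Proof.
move=> dF cf lg.
pose G t := oint 0 t g; pose Gam t := oint 0 t (fun u => `|g u|).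
have cG : continuous G := @continuous_oint _ _ lg.
have cF : continuous F.
  by move=> t; case: (dF t) => d _; exact/differentiable_continuous/derivable1_diffP.
have lfG : locint (fun t => f t * G t) by apply: locintM => //; exact: continuous_locint.
have lFg : locint (fun t => F t * g t) by exact: locintM.
have ln : locint (fun t => `|g t|) by exact: locint_norm.
pose H t := F t * G t - (oint 0 t (fun t => f t * G t) + oint 0 t (fun t => F t * g t)).
suff H0 : H x = H 0.
  by move: H0; rewrite /H /G !oint00 mulr0 addr0 subrr => /eqP; rewrite subr_eq0 => /eqP.
have key a b : a <= b -> H b = H a.
  move=> ab; have [C C0 fC] := continuous_bounded_itv a b cf.
  (* Each of the two terms in the increment of [H] contributes one [C]. *)
  apply: (@eq_of_superlinear_increments _ Gam (2 * C)) => //; first by rewrite mulr_ge0.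
  move=> u v au uv vb.
  have GB t : u <= t <= v -> `|G u - G t| <= Gam v - Gam u.
    move=> /andP[ut tv]; rewrite distrC ointB//.
    apply: le_trans (@normr_Rintegral_le g (fun t => `|g t|) _ _ lg ln _) _ => //.
    rewrite -ointB// lerD2r -subr_ge0 ointB//.
    by apply: Rintegral_ge0 => z _.
  have FB t : u <= t <= v -> `|F v - F t| <= C * (v - u).
    move=> /andP[ut tv]; rewrite -(@integral_derivative F f)//.
    apply: le_trans (@normr_Rintegral_le f (cst C) _ _ _ _ _) _.
    - exact: continuous_locint.
    - by apply: continuous_locint => z; exact: cst_continuous.
    - by move=> z /andP[tz zv]; apply: fC; rewrite (le_trans au (le_trans ut tz)) (le_trans zv vb).
    - by rewrite Rintegral_itv_cst// ler_wpM2l// lerD2l lerN2.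
  have lf : locint f by exact: continuous_locint.
  have lgZ (k : R) : locint (fun t => k * g t) by exact: locintZ.
  have lfZ (k : R) : locint (fun t => k * f t) by exact: locintZ.
  (* [F v G v - F u G u] is the integral of [F v g + G u f]. After subtraction each term has a small
     factor: [F v - F t] is [O(v - u)], and [G u - G t] is bounded by the increment of [Gam], while
     the other factor integrates to the missing increment. *)
  have -> : H v - H u = \int[mu]_(t in `[u, v]) ((F v - F t) * g t + f t * (G u - G t)).
    transitivity (\int[mu]_(t in `[u, v])
        ((F v * g t + G u * f t) - (f t * G t + F t * g t))); last first.
      by apply: eq_Rintegral => t _; ring.
    have l1 := locintD (lgZ (F v)) (lfZ (G u)).
    have l2 := locintD lfG lFg.
    rewrite RintegralB// (RintegralD _ (lgZ _ u v) (lfZ _ u v))//.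
    rewrite (RintegralD _ (lfG u v) (lFg u v))// !RintegralZl//.
    rewrite (@integral_derivative F)// -!ointB// /H -/(G v) -/(G u); ring.
  have lc (k : R) : locint (fun=> k).
    by apply: continuous_locint => z; exact: cst_continuous.
  have lnZ : locint (fun t => C * (v - u) * `|g t|) by exact: locintZ.
  apply: le_trans (@normr_Rintegral_le _
    (fun t => C * (v - u) * `|g t| + C * (Gam v - Gam u)) _ _ _ _ _) _.
  - apply: locintD.
      apply: locintM => // z; apply: cvgB; [exact: cvg_cst|exact: cF].
    apply: locintM => //; apply: continuous_locint => z.
    by apply: cvgB; [exact: cvg_cst|exact: cG].
  - exact: locintD.
  - move=> t /[dup] tuv /andP[ut tv]; apply: le_trans (ler_normD _ _) _.
    rewrite !normrM lerD// ?ler_wpM2r ?FB//.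
    by apply: ler_pM => //; [apply: fC; rewrite (le_trans au ut) (le_trans tv vb)|exact: GB].
  rewrite (RintegralD _ (lnZ u v) (lc _ u v))// RintegralZl// Rintegral_itv_cst// -ointB// -/(Gam v) -/(Gam u).
  by rewrite le_eqVlt; apply/orP; left; apply/eqP; ring.
have [x0|/ltW x0] := leP 0 x; first exact: key.
exact/esym/key.
Qed.

End IntegrationByParts.

(** * Reduction of words to powers times words without pure letters [t^n dt] *)

Section Reduction.
Variable R : realType.
Implicit Types (p q : nat * nat) (s w : seq (nat * nat)) (x t : R).

Lemma locint_layer p : locint (@layer R p).
Proof.
apply: locintM; first exact: exprn_continuous.
by move=> a b; exact: integrable_Afun_expr.
Qed.

Lemma continuous_nestint s : continuous (@nestint R s).
Proof.
elim: s => [|p s IH]; first by move=> x; exact: cst_continuous.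
apply: continuous_oint => a b.
rewrite (_ : (fun _ => _) = (fun t => nestint s t * layer p t)).
  exact: (locintM IH (locint_layer p)).
by apply/funext => t; rewrite mulrC.
Qed.

Lemma locint_nest p s : locint (fun t : R => layer p t * nestint s t).
Proof.
rewrite (_ : (fun _ => _) = (fun t => nestint s t * layer p t)).
  by apply: locintM; [exact: continuous_nestint|exact: locint_layer].
by apply/funext => t; rewrite mulrC.
Qed.

(** Multiplication of the form by [t^m]: the exponent of [A] is [k - 1 - l], so raising [l] alone
    would lower it. *)
Definition shift_letter m p := ((p.1 + m)%N, (p.2 + m)%N).

Lemma layer_shift m p t : layer (shift_letter m p) t = t ^+ m * layer p t.
Proof.
rewrite /layer /= exprD mulrA [t ^+ m * _]mulrC; congr (_ * _ ^+ _).
lia.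
Qed.

Lemma layer_pure n t : layer (n.+1, n) t = t ^+ n.
Proof. by rewrite /layer/= subn1/= subnn expr0 mulr1. Qed.

Lemma is_derive_exprS n t :
  is_derive t 1 (fun u : R => u ^+ n.+1) (n.+1%:R * t ^+ n).
Proof.
have := is_deriveX n.+1 (is_derive_id t (1 : R)).
by rewrite exprfctE /GRing.scale/= mulr1.
Qed.

Lemma continuous_Zexpr n (k : R) : continuous (fun u : R => k * u ^+ n).
Proof. by move=> t; apply: cvgM; [exact: cvg_cst|exact: exprn_continuous]. Qed.

(** The companion of the by-parts identity for the empty word, where there is no letter to shift and
    a single term is left. *)
Lemma nestint_pure n x : n.+1%:R * nestint [:: (n.+1, n)] x = x ^+ n.+1.
Proof.
rewrite /= -ointZ; last first.
  exact: (locint_nest _ [::]).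
rewrite (@eq_oint _ _ (fun t => n.+1%:R * t ^+ n)); last first.
  by move=> t; rewrite layer_pure mulr1.
rewrite (oint_derivative x (is_derive_exprS n) (@continuous_Zexpr n _)).
by rewrite expr0n subr0.
Qed.

(** Integration by parts with [F = t^(n+1)] and [g] the integrand of the outermost letter [p], which
    then absorbs the factor [t^(n+1)]. *)
Lemma nestint_by_parts n p s x :
  x ^+ n.+1 * nestint (p :: s) x =
  n.+1%:R * nestint [:: (n.+1, n), p & s] x +
  nestint (shift_letter n.+1 p :: s) x.
Proof.
rewrite [nestint (p :: s) x]/=.
rewrite (oint_by_parts x (is_derive_exprS n) (@continuous_Zexpr n _) (locint_nest p s)).
congr (_ + _).
  rewrite [in RHS]/= -ointZ; last exact: (locint_nest (n.+1, n) (p :: s)).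
  by apply: eq_oint => t; rewrite layer_pure mulrA.
by apply: eq_oint => t; rewrite layer_shift mulrA.
Qed.

Definition Lletter p := (1 <= p.1)%N && (p.2 + 1 <= p.1)%N.
Definition Mletter p := (2 <= p.1)%N && (p.2 + 2 <= p.1)%N.

(** A pair [(m, w)] stands for the function [t^m] times the iterated integral of [w]. *)
Definition Mword k e (z : nat * seq (nat * nat)) :=
  [&& all Mletter z.2, sdeg z.2 == e & (z.1 + wt z.2 == k)%N].

(* [e] is the exact degree [s(k, l)], not a bound: parity and the bound [d] follow. *)
Definition Mcomb k e (f : R -> R) :=
  exists r : seq (rat * (nat * seq (nat * nat))),
    all (fun z => Mword k e z.2) r /\
    forall t, f t = \sum_(z <- r) ratr z.1 * (t ^+ z.2.1 * nestint z.2.2 t).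

Lemma Mcomb1 k e m w : Mword k e (m, w) ->
  Mcomb k e (fun t => t ^+ m * nestint w t).
Proof.
move=> kw; exists [:: (1, (m, w))]; split; first by rewrite /= kw.
by move=> t; rewrite big_seq1 rmorph1 mul1r.
Qed.

Lemma McombD k e f g : Mcomb k e f -> Mcomb k e g -> Mcomb k e (fun t => f t + g t).
Proof.
move=> [r [rk rf]] [r' [rk' rg]]; exists (r ++ r'); split; first by rewrite all_cat rk.
by move=> t; rewrite big_cat/= -rf -rg.
Qed.

Lemma McombZ k e (c : rat) f : Mcomb k e f -> Mcomb k e (fun t => ratr c * f t).
Proof.
move=> [r [rk rf]]; exists [seq (c * z.1, z.2) | z <- r]; split.
  by rewrite all_map.
move=> t; rewrite rf big_map mulr_sumr; apply: eq_bigr => z _.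
by rewrite rmorphM mulrA.
Qed.

Lemma Mcomb_sum k e (I : Type) (P : pred I) (r : seq I) (c : I -> rat) (f : I -> R -> R) :
  all P r -> (forall i, P i -> Mcomb k e (f i)) ->
  Mcomb k e (fun t => \sum_(i <- r) ratr (c i) * f i t).
Proof.
move=> + cf; elim: r => [_|i r IH /= /andP[Pi /IH IHr]].
  by exists [::]; split => // t; rewrite !big_nil.
rewrite (_ : (fun _ => _) =
  (fun t => ratr (c i) * f i t + \sum_(i <- r) ratr (c i) * f i t)).
  by apply: McombD => //; apply: McombZ; exact: cf.
by apply/funext => t; rewrite big_cons.
Qed.

Lemma wt_cons p s : wt (p :: s) = (p.1 + wt s)%N.
Proof. by rewrite /wt big_cons. Qed.

Lemma sdeg_cons p s : sdeg (p :: s) = (p.1 - 1 - p.2 + sdeg s)%N.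
Proof. by rewrite /sdeg big_cons. Qed.

(** Either [p] carries a power of [A] and the word is already admissible, or the shifted letter is
    pure and the by-parts identity removes it. The next letter is then shifted, which keeps its
    power of [A], so one application is enough. *)
Lemma Mcomb_cons m p w : Lletter p -> all Mletter w ->
  Mcomb (p.1 + m + wt w)%N (p.1 - 1 - p.2 + sdeg w)%N (nestint (shift_letter m p :: w)).
Proof.
move=> Lp Mw; have [Mp|Mp] := boolP (Mletter p).
  rewrite (_ : nestint _ = fun t => t ^+ 0 * nestint (shift_letter m p :: w) t).
    apply: Mcomb1; rewrite /Mword /= Mw wt_cons sdeg_cons /= !andbT.
    move: Lp Mp; rewrite /Lletter /Mletter /=; lia.
  by apply/funext => t; rewrite mul1r.
set n := (p.2 + m)%N.
have pn : shift_letter m p = (n.+1, n).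
  by congr (_, _); move: Lp Mp; rewrite /Lletter /Mletter /n; lia.
have [pk pe] : (p.1 + m = n.+1)%N /\ (p.1 - 1 - p.2 = 0)%N.
  by move: Lp Mp; rewrite /Lletter /Mletter /n; lia.
rewrite pn pk pe add0n.
have n0 : n.+1%:R != 0 :> R by rewrite pnatr_eq0.
case: w Mw => [_|q w]; last rewrite [all _ _]/= => /andP[Mq Mw].
  rewrite (_ : nestint _ = fun t => ratr (n.+1%:R^-1) * (t ^+ n.+1 * nestint [::] t)).
    apply/McombZ/Mcomb1; rewrite /Mword /wt /sdeg !big_nil /=; lia.
  apply/funext => t; rewrite -nestint_pure mulr1 fmorphV rmorph_nat.
  by rewrite mulrA mulVf// mul1r.
(* The by-parts identity solved for the word with the pure letter; dividing by [n + 1] keeps the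
   coefficients rational. *)
rewrite (_ : nestint _ = fun t =>
    ratr (n.+1%:R^-1) * (t ^+ n.+1 * nestint (q :: w) t) +
    ratr (- n.+1%:R^-1) * (t ^+ 0 * nestint (shift_letter n.+1 q :: w) t)).
  apply: McombD; apply/McombZ/Mcomb1; rewrite /Mword !wt_cons !sdeg_cons /= Mw ?Mq.
    by rewrite !eqxx.
  by move: Mq; rewrite /Mletter/=; lia.
apply/funext => t; rewrite nestint_by_parts rmorphN /= !fmorphV !rmorph_nat expr0.
by move: (n.+1%:R) n0 => N N0; field.
Qed.

(** Induction from the innermost letter outwards. The expansion of the inner word holds at every
    [t], so it can be multiplied by the new layer and integrated term by term; each power [t^m] is
    absorbed by the new letter. *)
Lemma Mcomb_nestint s : all Lletter s -> Mcomb (wt s) (sdeg s) (nestint s).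
Proof.
elim: s => [_|p s IH]; last rewrite [all _ _]/= => /andP[Lp /IH[r [rk rs]]].
  rewrite (_ : nestint _ = fun t => t ^+ 0 * nestint [::] t).
    by apply: Mcomb1; rewrite /Mword /wt /sdeg !big_nil.
  by apply/funext => t; rewrite mul1r.
rewrite (_ : nestint _ = (fun x => \sum_(z <- r)
    ratr z.1 * nestint (shift_letter z.2.1 p :: z.2.2) x)); last first.
  apply/funext => x /=.
  rewrite (@eq_oint _ _ (fun t => \sum_(z <- r)
      ratr z.1 * (layer (shift_letter z.2.1 p) t * nestint z.2.2 t))).
    rewrite oint_sum => [|z]; last exact/locintZ/locint_nest.
    by apply: eq_bigr => z _; rewrite ointZ//; exact: locint_nest.
  move=> t; rewrite rs mulr_sumr; apply: eq_bigr => z _.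
  by rewrite layer_shift; ring.
apply: Mcomb_sum rk _ => z /and3P[Mw /eqP ez /eqP kz].
rewrite wt_cons sdeg_cons -ez -kz addnA.
exact: Mcomb_cons.
Qed.

End Reduction.

(** * Rational spans and the two inclusions *)

Section RationalSpan.
Variable R : realType.
Implicit Types (S T : set R) (s w : seq (nat * nat)) (x sigma : R).

Lemma mem_Qspan S x : S x -> Qspan S x.
Proof.
move=> Sx; exists [:: (1, x)]; rewrite /= mem_set//; split => //.
by rewrite big_seq1 rmorph1 mul1r.
Qed.

Lemma QspanD S x y : Qspan S x -> Qspan S y -> Qspan S (x + y).
Proof.
move=> [r [rS ->]] [r' [rS' ->]]; exists (r ++ r').
by rewrite all_cat rS rS' big_cat.
Qed.

Lemma QspanZ S (c : rat) x : Qspan S x -> Qspan S (ratr c * x).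
Proof.
move=> [r [rS ->]]; exists [seq (c * z.1, z.2) | z <- r]; rewrite all_map.
split=> //; rewrite big_map mulr_sumr; apply: eq_bigr => z _.
by rewrite rmorphM mulrA.
Qed.

Lemma Qspan_sum S (I : Type) (P : pred I) (r : seq I) (c : I -> rat) (f : I -> R) :
  all P r -> (forall i, P i -> Qspan S (f i)) ->
  Qspan S (\sum_(i <- r) ratr (c i) * f i).
Proof.
move=> + Sf; elim: r => [_|i r IH /= /andP[Pi /IH IHr]].
  by exists [::]; rewrite !big_nil.
by rewrite big_cons; apply: QspanD => //; apply: QspanZ; exact: Sf.
Qed.

Lemma Qspan_subset S T : S `<=` Qspan T -> Qspan S `<=` Qspan T.
Proof.
move=> ST x [r [rS ->]].
by apply: Qspan_sum rS _ => z; rewrite inE => /ST.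
Qed.

Lemma wt_rev s : wt (rev s) = wt s.
Proof. by rewrite /wt big_rev. Qed.

Lemma sdeg_rev s : sdeg (rev s) = sdeg s.
Proof. by rewrite /sdeg big_rev. Qed.

(** Words list the outermost letter first and the indices of [Ls] the innermost first, hence [rev];
    the sign is written as a rational so that spans absorb it. *)
Lemma nestint_Ls s sigma :
  nestint s sigma = ratr ((-1) ^+ size s) * Ls (rev s) sigma.
Proof.
rewrite /Ls revK size_rev rmorphXn rmorphN1 mulrA -exprMn.
by rewrite mulrNN mulr1 expr1n mul1r.
Qed.

(** Each letter weighs at least 1. This supplies the bound on the number of letters in [Lset] and
    [Mset]. *)
Lemma size_le_wt s : all Lletter s -> (size s <= wt s)%N.
Proof.
elim: s => [//|p s IH] /= /andP[/andP[p1 _] /IH]; rewrite wt_cons; lia.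
Qed.

Lemma Mletter_Lletter s : all Mletter s -> all Lletter s.
Proof. by apply: sub_all => p; rewrite /Mletter /Lletter; lia. Qed.

Lemma nestint_Lspan s par k d sigma : all Lletter s -> wt s = k ->
  (sdeg s <= d)%N -> odd (sdeg s) = par ->
  Qspan (Lset par k d sigma) (nestint s sigma).
Proof.
move=> Ls <- sd <-; rewrite nestint_Ls; apply/QspanZ/mem_Qspan; exists (rev s).
rewrite size_rev wt_rev all_rev sdeg_rev; split => //; exact: size_le_wt.
Qed.

Lemma nestint_Mspan m s d sigma : all Mletter s -> (sdeg s <= d)%N ->
  Qspan (Mset (odd (sdeg s)) (m + wt s) d sigma) (sigma ^+ m * nestint s sigma).
Proof.
move=> Ms sd; rewrite nestint_Ls mulrCA; apply/QspanZ/mem_Qspan; exists m, (rev s).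
rewrite size_rev wt_rev all_rev sdeg_rev; split => //.
exact: leq_trans (size_le_wt (Mletter_Lletter Ms)) (leq_addl _ _).
Qed.

(** The expansion of the word is evaluated at [sigma]; all its terms share the weight and the degree
    of the word, hence also its parity. *)
Lemma Lset_sub_Mspan par k d sigma :
  Lset par k d sigma `<=` Qspan (Mset par k d sigma).
Proof.
move=> _ [kl [_ <- Lkl [sd <- ->]]]; rewrite -[kl]revK.
set s := rev kl; have Ls : all Lletter s by rewrite all_rev.
have [r [rk rs]] := Mcomb_nestint R Ls.
rewrite /Defs.Ls revK rs -(rmorphN1 (ratr : rat -> R)) -rmorphXn.
apply/QspanZ; rewrite wt_rev sdeg_rev.
apply: Qspan_sum rk _ => z /and3P[Mz /eqP ez /eqP kz].
rewrite -ez -kz; apply: nestint_Mspan => //.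
by rewrite ez sdeg_rev.
Qed.

(** One use of the by-parts identity absorbs the whole power of [sigma], since pure letters are
    allowed in [Lset]. *)
Lemma Mset_sub_Lspan par k d sigma :
  Mset par k d sigma `<=` Qspan (Lset par k d sigma).
Proof.
move=> _ [m [kl [_ <- Mkl [sd <- ->]]]]; rewrite -[kl]revK.
set s := rev kl; have Ms : all Mletter s by rewrite all_rev.
have Ls := Mletter_Lletter Ms.
rewrite /Defs.Ls revK mulrCA -(rmorphN1 (ratr : rat -> R)) -rmorphXn.
apply/QspanZ; rewrite wt_rev sdeg_rev.
have {}sd : (sdeg s <= d)%N by rewrite sdeg_rev.
case: m => [|n]; first by rewrite mul1r; exact: nestint_Lspan.
move: (Ls) sd; case: (s) => [_ _|p s' Lps sd].
  (* On the empty word the power itself is [n + 1] times the integral of [t^n]. *)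
  rewrite mulr1 -nestint_pure -(rmorph_nat (ratr : rat -> R)); apply: QspanZ.
  apply: nestint_Lspan; rewrite ?wt_cons ?sdeg_cons ?[sdeg [::]]big_nil /=.
  - by rewrite /Lletter/= addn1 leqnn.
  - by [].
  - by rewrite subn1 subnn.
  - by rewrite subn1 subnn.
rewrite nestint_by_parts; apply: QspanD.
  rewrite -(rmorph_nat (ratr : rat -> R)); apply: QspanZ.
  apply: nestint_Lspan.
  - by rewrite /= /Lletter/= addn1 leqnn.
  - by rewrite wt_cons.
  - by rewrite sdeg_cons/= subn1 subnn.
  - by rewrite sdeg_cons/= subn1 subnn.
have [Lp Ls'] : Lletter p /\ all Lletter s' by apply/andP.
have E : sdeg (shift_letter n.+1 p :: s') = sdeg (p :: s').
  by rewrite !sdeg_cons /=; congr (_ + _)%N; lia.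
apply: nestint_Lspan; rewrite ?E//.
- by rewrite /= Ls' andbT; move: Lp; rewrite /Lletter/=; lia.
- by rewrite !wt_cons /=; lia.
Qed.

End RationalSpan.

Theorem theorem8 (R : realType) (sigma : R) (k d : nat) :
  Qspan (Lset true k d sigma) = Qspan (Mset true k d sigma) /\
  Qspan (Lset false k d sigma) = Qspan (Mset false k d sigma).
Proof.
by split; apply/seteqP; split; apply: Qspan_subset;
  (exact: Lset_sub_Mspan || exact: Mset_sub_Lspan).
Qed.
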